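(* Let $A=(a_{ij})$ be a nonzero $m\times n$ complex matrix, and let $\sigma(A)$ denote its largest singular value. For $i\in[m]$ and $j\in[n]$ set $r_i=\sum_{k\in[n]}|a_{ik}|$ and $c_j=\sum_{k\in[m]}|a_{kj}|$. Then $$\sigma^{2}(A)\le \max_{i\in[m]}\sum_{j\in[n]}|a_{ij}|\,c_j\le \max_{(i,j)\in[m]\times[n],\ a_{ij}\neq 0} r_i c_j .$$
   Context: For a positive integer $N$, $[N]=\{1,\dots,N\}$. The notation $\sigma^2(A)$ means $(\sigma(A))^2$. *)

(* Defs.v *)
From mathcomp Require Import all_boot all_order all_algebra.
From mathcomp Require Import sesquilinear spectral complex.
From mathcomp Require Import boolp classical_sets reals.

Set Implicit Arguments.
Unset Strict Implicit.
Unset Printing Implicit Defensive.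

Import Order.TTheory GRing.Theory Num.Theory.
Import ComplexField.Normc.

Local Open Scope ring_scope.
Local Open Scope sesquilinear_scope.
Local Open Scope complex_scope.
Local Open Scope classical_set_scope.

(* The complex numbers are [R[i]] for [R : realType], and [normc z : R] is the
   modulus of [z] as a real number (the norm [`|z|] is its image in [R[i]]). *)

(* The nonnegative square roots of the eigenvalues of A^* A. When m < n this
   adds 0 to the min(m, n) singular values of the other usual convention; the
   largest one is the same. *)
Definition singular_value (R : realType) (m n : nat) (A : 'M[R[i]]_(m, n)) :
    set R :=
  [set s : R | 0 <= s /\ eigenvalue (A^t* *m A) (s ^+ 2)%:C].

(* The supremum is a maximum, see [largest_singular_valueP]. *)
Definition largest_singular_value (R : realType) (m n : nat)
    (A : 'M[R[i]]_(m, n)) : R :=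
  sup (singular_value A).

Definition abs_row_sum (R : realType) (m n : nat) (A : 'M[R[i]]_(m, n))
    (i : 'I_m) : R :=
  \sum_(k < n) normc (A i k).

Definition abs_col_sum (R : realType) (m n : nat) (A : 'M[R[i]]_(m, n))
    (j : 'I_n) : R :=
  \sum_(k < m) normc (A k j).

Lemma eigenvalue_gram_ge0 (R : realType) (m n : nat) (A : 'M[R[i]]_(m, n))
    (a : R[i]) : eigenvalue (A^t* *m A) a -> 0 <= a.
Proof.
have sq_ge0 k (u : 'rV[R[i]]_k) : 0 <= (u *m u^t*) 0 0.
  by rewrite mxE sumr_ge0 // => i _; rewrite !mxE mul_conjC_ge0.
move=> /eigenvalueP[v Av v0].
have vv_gt0 : 0 < (v *m v^t*) 0 0.
  by rewrite -dotmxE dotmx_is_dotmx.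
have := sq_ge0 _ (v *m A^t*).
rewrite trmx_mul map_mxM trmxCK mulmxA -(mulmxA v) Av -scalemxAl mxE.
by rewrite pmulr_lge0.
Qed.

Lemma largest_singular_valueP (R : realType) (m n : nat)
    (A : 'M[R[i]]_(m, n)) : A != 0 ->
  singular_value A (largest_singular_value A) /\
  forall s, singular_value A s -> s <= largest_singular_value A.
Proof.
move=> A0; have n_gt0 : (0 < n)%N.
  by case: n A A0 => // A; rewrite thinmx0 eqxx.
pose f (a : R[i]) : R := Num.sqrt (complex.Re a).
have fP a : eigenvalue (A^t* *m A) a -> singular_value A (f a).
  move=> Aa; have := eigenvalue_gram_ge0 Aa.
  case: a Aa => x y Aa; rewrite lecE /= => /andP[/eqP y0 x0].
  rewrite {}y0 in Aa; split; first exact: sqrtr_ge0.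
  by rewrite /f [_ ^+ 2]sqr_sqrtr.
have Kf s : 0 <= s -> f (s ^+ 2)%:C = s.
  by move=> s0; rewrite /f /= sqrtr_sqr ger0_norm.
have [rs rsE] := closed_field_poly_normal (char_poly (A^t* *m A)).
rewrite (monicP (char_poly_monic _)) scale1r in rsE.
have rsP a : eigenvalue (A^t* *m A) a = (a \in rs).
  by rewrite eigenvalue_root_char rsE root_prod_XsubC.
have [a0 Aa0] := eigenvalue_closed (A^t* *m A) n_gt0.
have [s Ss s_max] : exists2 s, singular_value A s &
    forall t, singular_value A t -> t <= s.
  have [a a_rs aM] : exists2 a, a \in rs & forall b, b \in rs -> f b <= f a.
    have : rs != [::] by apply/negP => /eqP E; rewrite rsP E in Aa0.
    elim: rs {rsE rsP} => // b [|c l] IH _.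
      by exists b; rewrite ?mem_head // => x; rewrite inE => /eqP->.
    have [a al aM] := IH isT.
    case: (leP (f b) (f a)) => ba.
      exists a; first by rewrite in_cons al orbT.
      by move=> x; rewrite in_cons => /predU1P[->//|/aM].
    exists b; first exact: mem_head.
    move=> x; rewrite in_cons => /predU1P[->//|/aM xa].
    exact: le_trans xa (ltW ba).
  exists (f a); first by apply: fP; rewrite rsP.
  by move=> t [t0 At]; rewrite -[t]Kf //; apply: aM; rewrite -rsP.
suff -> : largest_singular_value A = s by [].
have Ssup : has_sup (singular_value A).
  by split; [exists s | exists s => t; exact: s_max].
apply/eqP; rewrite eq_le; apply/andP; split.
- by apply: ge_sup => [|t]; [exists s | exact: s_max].
- exact: (sup_upper_bound Ssup).
Qed.

(* Main.v *)
(** A nonzero eigenvalue [s ^+ 2] of [A^* A] is also an eigenvalue of [A A^*],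
   so it is at most the maximal l1-norm of a row of [A A^*]; by the triangle
   inequality, row [i] has l1-norm at most [\sum_j |a_ij| c_j]. For the second
   inequality, this sum times [r_i] is [\sum_j |a_ij| r_i c_j], at most [r_i]
   times the largest [r_i c_j] over nonzero entries, and [r_i] cancels. *)
Require Import Defs.
From mathcomp Require Import all_boot all_order all_algebra.
From mathcomp Require Import sesquilinear complex reals.

Set Implicit Arguments.
Unset Strict Implicit.
Unset Printing Implicit Defensive.

Import Order.TTheory GRing.Theory Num.Theory.
Import ComplexField.Normc.

Local Open Scope ring_scope.
Local Open Scope complex_scope.

(** If [v] is a left eigenvector of [A *m B], then [v *m A] is one of [B *m A]; it is nonzero
    because [v *m A = 0] would force [a *: v = 0]. *)
Lemma eigenvalue_mulmx_swap (F : fieldType) (m n : nat) (A : 'M[F]_(m, n))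
    (B : 'M[F]_(n, m)) (a : F) :
  a != 0 -> eigenvalue (A *m B) a -> eigenvalue (B *m A) a.
Proof.
move=> a0 /eigenvalueP[v ABv v0]; apply/eigenvalueP; exists (v *m A).
  by rewrite mulmxA -(mulmxA v) ABv scalemxAl.
apply: contra_neq v0 => vA0; apply/eqP.
by have /eqP := ABv; rewrite mulmxA vA0 mul0mx eq_sym scaler_eq0 (negPf a0).
Qed.

(** Compare the l1-norms of both sides of [v *m B = a *: v]: after exchanging sums, [|v_i|] is the
    weight of the l1-norm of row [i] of [B]. *)
Lemma norm_eigenvalue_le_row_sum (F : numFieldType) (n : nat) (B : 'M[F]_n)
    (a M : F) :
  (forall i, \sum_k `|B i k| <= M) -> eigenvalue B a -> `|a| <= M.
Proof.
move=> BM /eigenvalueP[v Bv v0].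
have v_gt0 : 0 < \sum_k `|v 0 k|.
  rewrite lt_def sumr_ge0 // andbT; apply: contra_neq v0 => /psumr_eq0P v0.
  by apply/rowP => k; rewrite mxE; apply/normr0_eq0/v0.
rewrite -(ler_pM2r v_gt0) mulr_sumr.
have -> : \sum_k `|a| * `|v 0 k| = \sum_k `|(v *m B) 0 k|.
  by apply: eq_bigr => k _; rewrite Bv mxE normrM.
apply: (@le_trans _ _ (\sum_k \sum_i `|v 0 i| * `|B i k|)).
  apply: ler_sum => k _; rewrite mxE; apply: le_trans (ler_norm_sum _ _ _) _.
  by apply: ler_sum => i _; rewrite normrM.
rewrite exchange_big mulr_sumr /=; apply: ler_sum => i _.
by rewrite -mulr_sumr mulrC ler_wpM2r.
Qed.

Lemma normc_ge0 (R : rcfType) (z : R[i]) : 0 <= normc z.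
Proof. by case: z => x y; exact: sqrtr_ge0. Qed.

Section NormSums.
Variables (R : realType) (m n : nat) (A : 'M[R[i]]_(m, n)).
Local Open Scope sesquilinear_scope.

Lemma abs_col_sum_ge0 j : 0 <= abs_col_sum A j.
Proof. by apply: sumr_ge0 => k _; exact: normc_ge0. Qed.

Lemma abs_row_sum_ge0 i : 0 <= abs_row_sum A i.
Proof. by apply: sumr_ge0 => k _; exact: normc_ge0. Qed.

Lemma gram_row_sum_le i :
  \sum_k `|(A *m A^t*) i k| <= (\sum_j normc (A i j) * abs_col_sum A j)%:C.
Proof.
have -> : (\sum_j normc (A i j) * abs_col_sum A j)%:C
    = \sum_k \sum_j `|A i j| * `|A k j|.
  rewrite exchange_big rmorph_sum /=; apply: eq_bigr => j _.
  by rewrite -mulr_sumr rmorphM rmorph_sum.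
apply: ler_sum => k _; rewrite mxE; apply: le_trans (ler_norm_sum _ _ _) _.
by apply: ler_sum => j _; rewrite !mxE normrM norm_conjC.
Qed.

Lemma sqr_singular_value_le (s M : R) :
  0 <= M -> (forall i, \sum_j normc (A i j) * abs_col_sum A j <= M) ->
  singular_value A s -> s ^+ 2 <= M.
Proof.
(* The eigenvalue 0 need not pass from [A^* A] to [A A^*]; there the bound is [0 <= M]. *)
move=> M0 AM [s0 As]; have [->|s2_neq0] := eqVneq (s ^+ 2) 0; first by [].
have sC0 : (s ^+ 2)%:C != 0 by rewrite fmorph_eq0.
have sqC_ge0 : 0 <= (s ^+ 2)%:C by rewrite ler0c sqr_ge0.
rewrite -lecR -(ger0_norm sqC_ge0).
apply: norm_eigenvalue_le_row_sum (eigenvalue_mulmx_swap sC0 As) => i.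
by apply: le_trans (gram_row_sum_le i) _; rewrite lecR.
Qed.

Lemma weighted_col_sum_le (i : 'I_m) (M : R) :
  0 <= M ->
  (forall j, A i j != 0 -> abs_row_sum A i * abs_col_sum A j <= M) ->
  \sum_j normc (A i j) * abs_col_sum A j <= M.
Proof.
move=> M0 rcM; have := abs_row_sum_ge0 i.
rewrite le0r => /predU1P[r0|r_gt0].
  (* Here [r_i] cannot be cancelled, but row [i] is zero and so is the sum. *)
  rewrite big1 // => j _.
  by rewrite (psumr_eq0P _ r0) ?mul0r // => k _; exact: normc_ge0.
(* On the right, [r_i * M] is expanded as the sum of the [|a_ij| * M], so that the two sides compare
   term by term. *)
rewrite -(ler_pM2l r_gt0) mulr_sumr mulr_suml; apply: ler_sum => j _.
rewrite mulrCA; have [->|Aij] := eqVneq (A i j) 0.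
  by rewrite normc0 !mul0r.
by rewrite ler_wpM2l ?normc_ge0 ?rcM.
Qed.

End NormSums.

(* The maxima are taken over nonempty sets of nonnegative reals (A is nonzero),
   so the default value 0 of the big operators does not affect them. *)
Theorem mainTheorem1 (R : realType) (m n : nat) (A : 'M[R[i]]_(m, n))
    (hA : A != 0) :
  largest_singular_value A ^+ 2
    <= \big[Num.max/0]_(i < m) \sum_(j < n) normc (A i j) * abs_col_sum A j
    <= \big[Num.max/0]_(p : 'I_m * 'I_n | A p.1 p.2 != 0)
         (abs_row_sum A p.1 * abs_col_sum A p.2).
Proof.
apply/andP; split.
  have [As _] := largest_singular_valueP hA.
  apply: sqr_singular_value_le As; first exact: bigmax_ge_id.
  by move=> i; exact: le_bigmax.
apply: bigmax_le => [|i _]; first exact: bigmax_ge_id.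
apply: weighted_col_sum_le => [|j Aij]; first exact: bigmax_ge_id.
exact: (@le_bigmax_cond _ _ _ 0 (i, j)
  (fun p : 'I_m * 'I_n => A p.1 p.2 != 0)
  (fun p => abs_row_sum A p.1 * abs_col_sum A p.2)).
Qed.
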